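(* Let $G_D$ be data with uniform sketch dimensions and let $T_0=\{(U_1,V_1),\dots,(U_{N-1},V_{N-1})\}$ be a given contraction tree of $G_D$. For any embedding $G_E$ satisfying the $(\epsilon,\delta)$-accurate sufficient condition with only one output sketch dimension, and any contraction tree $T_B$ of $(G_D,G_E)$ constrained on $T_0$, the sketching asymptotic cost is lower bounded by $$\Omega\left(\sum_{j=1}^N\exp(\mathrm{cut}_G(v_j))\cdot m+\sum_{i=1}^{N-1}y_i\right),$$ where $m=\Omega(N\log(1/\delta)/\epsilon^2)$ represents the embedding sketch size, $v_j$ is the vertex in $V_D$ adjacent to $e_j$ (so $\exp(\mathrm{cut}_G(v_j))$ is the size of the tensor at $v_j$), and $$y_i=a_ib_ic_id_im^2+m^2d_i\sqrt{a_ib_ic_im}\cdot\min(\sqrt{a_i},\sqrt{c_i}).$$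
   Context: **Tensor networks.** A tensor network is an undirected hypergraph $G=(V,E,w)$: each vertex is a tensor, each hyperedge a tensor dimension, $w(e)\ge0$ the natural log of the dimension size. A hyperedge is uncontracted if it has a dangling end (not adjacent to a vertex), and contracted otherwise (adjacent to at least two vertices). **Data and embedding.** The data $G_D=(V_D,E_D,w)$ is a hypergraph tensor network with a set $\bar E=\{e_1,\dots,e_N\}\subseteq E_D$ of uncontracted edges to be sketched; $e_j$ is adjacent to exactly one vertex $v_j\in V_D$, the $v_j$ are distinct, and $s_j=\exp(w(e_j))$. Uniform sketch dimensions means each vertex of $V_D$ is adjacent to an edge of $\bar E$, so $N=|V_D|$. An embedding is a graph tensor network $G_E=(V_E,E_E,w)$, $N_E=|V_E|$, with $\bar E\subseteq E_E$: in the combined network $e_j$ joins $v_j$ to an embedding vertex; the other edges of $E_E$ join two embedding vertices or are uncontracted output edges $E_1\subset E_E$ adjacent to one embedding vertex. The sketch size is $m=\exp(\sum_{e\in E_1}w(e))$. Standing assumption: each $s_j>m$. The combined network is $G=(V,E,w)$, $V=V_E\cup V_D$, $E=E_E\cup E_D$; also $L=(V,E_E,w)$, $R=(V,E\setminus E_E,w)$. **Cuts and cost.** For a (hyper)graph $H$ on $V$ and disjoint $A,B\subseteq V$: $\mathrm{cut}_H(A,B)$ is the total weight of hyperedges adjacent to both $A$ and $B$; $\mathrm{cut}_H(A,* )$ the total weight of uncontracted hyperedges adjacent only to vertices of $A$; $\mathrm{cut}_H(A)=\mathrm{cut}_H(A,V\setminus A)+\mathrm{cut}_H(A,* )$. $\mathrm{cost}_H(A,B)=\mathrm{cut}_H(A)+\mathrm{cut}_H(B)-\mathrm{cut}_H(A,B)$.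 **Contraction trees.** A contraction tree of a network on $V$ is a rooted binary tree whose vertices are subsets of $V$, leaves are singletons, the root is $V$, and each internal vertex $W$ is the disjoint union of its children $W_1,W_2$ (the contraction $(W_1,W_2)$). Contracting $(W_1,W_2)$ costs $\exp(\mathrm{cost}_G(W_1,W_2))$, and the (sketching asymptotic) cost of $T_B$ is the sum over all contractions, considered up to absolute constants. $T_B$ for $(G_D,G_E)$ is constrained on $T_0$ (a contraction tree of $G_D$) if for each $(A,B)\in T_0$ there is $(\hat A,\hat B)\in T_B$ with $\hat A\cap V_D=A$, $\hat B\cap V_D=B$. **Sufficient condition.** A sketching linearization $G_S$ is obtained by choosing an ordering of $V$ in which data vertices precede embedding vertices, and directing every contracted edge of $L$ to its higher-indexed endpoint and every uncontracted edge outward; $\mathrm{cut}_{G_S}(v)$ is the total weight of edges leaving $v$ (including outward dangling ones). The embedding satisfies the $(\epsilon,\delta)$-accurate sufficient condition with one output sketch dimension if $|E_1|=1$, $m=\Theta(N_E\log(1/\delta)/\epsilon^2)$, and some sketching linearization has effective sketch dimension of size $\Omega(N_E\log(1/\delta)/\epsilon^2)$ at each embedding vertex, taken as $\mathrm{cut}_{G_S}(v)\ge\log m$ for all $v\in V_E$. **Notation for $T_0$.** $a_i=\exp(\mathrm{cut}_R(U_i)-\mathrm{cut}_R(U_i,V_i))$, $c_i=\exp(\mathrm{cut}_R(V_i)-\mathrm{cut}_R(U_i,V_i))$, $d_i=\exp(\mathrm{cut}_R(U_i\cup V_i))/(a_ic_i)$, $b_i=\exp(\mathrm{cut}_R(U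_i,V_i))/d_i$.
   Formalization: The relation m = Ω(N log(1/δ)/ε²) is assumed (with an arbitrary implied constant that does not affect the lower bound) rather than concluded, since it fails for an embedding with a single vertex (N_E = 1) and large N; the cost bound itself covers all embeddings. *)

(* Defs.v *)
From HB Require Import structures.
From mathcomp Require Import all_boot all_order all_algebra.
From mathcomp Require Import reals sequences exp.

Set Implicit Arguments.
Unset Strict Implicit.
Unset Printing Implicit Defensive.

Import Order.TTheory GRing.Theory Num.Theory.
Local Open Scope ring_scope.

(* All networks have their vertices and edges in common ambient finite types,
   so that a data network and an embedding can share edges and the combined
   network is a union. Parallel edges are allowed. [weight] is the natural
   logarithm of the dimension size. *)
Record network (R : realType) (V E : finType) := Network {
  vset : {set V};
  eset : {set E};
  adj : E -> {set V};
  uncontracted : {set E};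
  weight : E -> R }.

Record is_network (R : realType) (V E : finType) (G : network R V E) : Prop :=
  IsNetwork {
  uncontracted_sub : uncontracted G \subset eset G;
  adj_sub : {in eset G, forall e, adj G e \subset vset G};
  adj_uncontracted : {in uncontracted G, forall e, (0 < #|adj G e|)%N};
  adj_contracted :
    {in eset G :\: uncontracted G, forall e, (1 < #|adj G e|)%N};
  weight_ge0 : {in eset G, forall e, 0 <= weight G e} }.

Definition is_graph (R : realType) (V E : finType) (G : network R V E) : Prop :=
  {in eset G, forall e, #|adj G e| = if e \in uncontracted G then 1%N else 2%N}.

Definition edge_restrict (R : realType) (V E : finType) (G : network R V E)
    (F : {set E}) : network R V E :=
  Network (vset G) (eset G :&: F) (adj G) (uncontracted G :&: F) (weight G).

(* The edges shared by the two networks are those along which they are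
   contracted: such an edge has a dangling end in each network, and these two
   ends are joined in the combined network. *)
Definition combine (R : realType) (V E : finType) (G H : network R V E) :
    network R V E :=
  Network (vset G :|: vset H) (eset G :|: eset H)
    (fun e => (if e \in eset G then adj G e else set0)
          :|: (if e \in eset H then adj H e else set0))
    ((uncontracted G :|: uncontracted H) :\: (eset G :&: eset H))
    (fun e => if e \in eset G then weight G e else weight H e).

Section Cuts.
Variables (R : realType) (V E : finType) (G : network R V E).
Implicit Types A B : {set V}.

Definition touches (e : E) A : bool := adj G e :&: A != set0.

Definition cut_between A B : R :=
  \sum_(e in eset G | touches e A && touches e B) weight G e.

Definition cut_dangling A : R :=
  \sum_(e in eset G | (e \in uncontracted G) && (adj G e \subset A)) weight G e.

Definition net_cut A : R := cut_between A (vset G :\: A) + cut_dangling A.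

Definition contraction_cost A B : R := net_cut A + net_cut B - cut_between A B.

End Cuts.

(* A contraction tree is given by its shape and leaves; the subset of vertices
   attached to a node is the set of leaves below it. *)
Inductive ctree (V : Type) := CLeaf of V | CNode of ctree V & ctree V.

Fixpoint leaves (V : finType) (t : ctree V) : {set V} :=
  match t with
  | CLeaf v => [set v]
  | CNode l r => leaves l :|: leaves r
  end.

Fixpoint disjoint_children (V : finType) (t : ctree V) : bool :=
  match t with
  | CLeaf _ => true
  | CNode l r =>
      [&& disjoint_children l, disjoint_children r &
          [disjoint leaves l & leaves r]]
  end.

Fixpoint contractions (V : finType) (t : ctree V) : seq ({set V} * {set V}) :=
  match t with
  | CLeaf _ => [::]
  | CNode l r => (leaves l, leaves r) :: contractions l ++ contractions r
  end.

Definition contraction_tree (R : realType) (V E : finType) (G : network R V E)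
    (t : ctree V) : Prop :=
  disjoint_children t /\ leaves t = vset G.

Definition tree_cost (R : realType) (V E : finType) (G : network R V E)
    (t : ctree V) : R :=
  \sum_(p <- contractions t) expR (contraction_cost G p.1 p.2).

(* Contractions are unordered pairs, hence the two cases. *)
Definition constrained_on (V : finType) (VD : {set V}) (T0 TB : ctree V) : Prop :=
  forall A B, (A, B) \in contractions T0 ->
  exists A' B', [/\ A' :&: VD = A, B' :&: VD = B &
    (A', B') \in contractions TB \/ (B', A') \in contractions TB].

(* [GD] is data with edges to be sketched [e 0, ..., e (N-1)], [v j] being the
   vertex adjacent to [e j]. *)
Record is_data (R : realType) (V E : finType) (GD : network R V E)
    (N : nat) (e : 'I_N -> E) (v : 'I_N -> V) : Prop := IsData {
  data_network : is_network GD;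
  sketched_inj : injective e;
  sketched_uncontracted : forall j, e j \in uncontracted GD;
  sketched_adj : forall j, adj GD (e j) = [set v j];
  sketched_vertex_inj : injective v }.

Definition uniform_sketch_dims (R : realType) (V E : finType)
    (GD : network R V E) (N : nat) (e : 'I_N -> E) : Prop :=
  {in vset GD, forall x, exists j, x \in adj GD (e j)}.

Section Embedding.
Variables (R : realType) (V E : finType) (GD GE : network R V E).

(* Taken alone, an embedding has the edges [e j] as uncontracted input edges,
   each adjacent to one embedding vertex by [is_graph]. *)
Record is_embedding (N : nat) (e : 'I_N -> E) : Prop := IsEmbedding {
  embedding_network : is_network GE;
  embedding_graph : is_graph GE;
  embedding_vertices : [disjoint vset GD & vset GE];
  embedding_shared : eset GD :&: eset GE = [set e j | j : 'I_N];
  embedding_inputs : forall j, e j \in uncontracted GE;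
  embedding_weight : forall j, weight GE (e j) = weight GD (e j) }.

Definition full_network : network R V E := combine GD GE.

Definition left_network : network R V E :=
  edge_restrict full_network (eset GE).

Definition right_network : network R V E :=
  edge_restrict full_network (~: eset GE).

Definition output_edges : {set E} := uncontracted full_network :&: eset GE.

Definition sketch_size : R :=
  expR (\sum_(e in output_edges) weight full_network e).

Definition vertex_ordering (s : seq V) : Prop :=
  [/\ uniq s, s =i vset full_network &
      {in vset GD & vset GE, forall x y, (index x s < index y s)%N}].

(* Weight of the edges leaving [x] in the sketching linearization given by [s]:
   contracted edges of the left network (which all have two endpoints) are
   directed towards the higher endpoint, uncontracted ones outward. *)
Definition linearization_cut (s : seq V) (x : V) : R :=
  \sum_(e in eset left_network |
         (x \in adj left_network e) &&
         ((e \in uncontracted left_network) ||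
          [exists y in adj left_network e, (index x s < index y s)%N]))
    weight left_network e.

(* [k1] and [k2] are the implied constants of
   [m = Theta(N_E log(1/delta) / eps^2)]. *)
Definition accurate_one_output (eps delta k1 k2 : R) : Prop :=
  let size_scale := #|vset GE|%:R * ln (delta^-1) / eps ^+ 2 in
  [/\ #|output_edges| = 1%N,
      k1 * size_scale <= sketch_size <= k2 * size_scale &
      exists2 s : seq V, vertex_ordering s &
        {in vset GE, forall x, ln sketch_size <= linearization_cut s x}].

End Embedding.

Section LowerBoundTerm.
Variables (R : realType) (V E : finType) (H : network R V E).
Variables (A B : {set V}).

Definition a_factor : R := expR (net_cut H A - cut_between H A B).
Definition c_factor : R := expR (net_cut H B - cut_between H A B).
Definition d_factor : R := expR (net_cut H (A :|: B)) / (a_factor * c_factor).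
Definition b_factor : R := expR (cut_between H A B) / d_factor.

Definition y_term (m : R) : R :=
  a_factor * b_factor * c_factor * d_factor * m ^+ 2
  + m ^+ 2 * d_factor * Num.sqrt (a_factor * b_factor * c_factor * m)
    * Num.min (Num.sqrt a_factor) (Num.sqrt c_factor).

End LowerBoundTerm.

(* Main.v *)
Require Import Defs.
From HB Require Import structures.
From mathcomp Require Import all_boot all_order all_algebra.
From mathcomp Require Import reals sequences exp.
From mathcomp Require Import ring lra.

Set Implicit Arguments.
Unset Strict Implicit.
Unset Printing Implicit Defensive.

Import Order.TTheory GRing.Theory Num.Theory.
Local Open Scope ring_scope.

(** Write [mu] for the logarithm of the sketch size. A sketching linearization
    directs the edges of the left network, and every vertex then has outgoing
    weight at least [mu]: an embedding vertex by the sufficient condition, a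
    data vertex through its sketched edge, whose dimension exceeds the sketch
    size. Since the last vertex of a set sends all its outgoing weight out of
    the set, at least [mu] leaves every nonempty set ([leaving_ge]). A
    contraction of A with B costs, in the left network, at least what enters
    the union plus what leaves A plus what leaves B ([contraction_cost_flow]),
    hence at least [2 mu]; the right network adds the cost of contracting the
    data parts of A and B.

    Let (A, B) be a contraction that realizes a contraction of T0. Its own cost
    bounds the first summand of the term. For the second summand, some operand
    X, equal to A or to B, satisfies [leaving (A :|: B) >= 2 mu - rho] where
    [rho] is the weight that enters X ([leavingU]). The contraction that formed
    X then costs [2 mu + rho] in flow, and the contraction that consumes the
    union costs [3 mu - rho]. The unknown [rho] cancels in their geometric mean,
    which is the second summand with [a] or [c] in place of the minimum
    ([y_term_le], [neighbourhood_term]).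

    Hence each term is at most twice the cost of a contraction and of its
    neighbours in the tree. Every contraction has few neighbours
    ([sum_neighbourhoods]) and realizes few contractions of T0 ([sum_charge]),
    so these bounds add up to a multiple of the total cost. The tensors [v j]
    are leaves of the tree: contracting [v j] with a set pays for all edges open
    at [v j] and for [mu] leaving the other set ([leaf_cost], [sum_leaves]). *)

(** * Cuts as weighted edge counts *)

Section EdgeCount.
Variables (R : realType) (V E : finType) (G : network R V E).
Implicit Types (f g : E -> nat) (P : pred E) (A B : {set V}).

(** Multiplicities are natural numbers, so that an inequality between sums of
    cuts reduces to an inequality between numbers of 0/1 conditions on one
    edge. *)
Definition edge_count f : R := \sum_(e in eset G) weight G e *+ f e.

Lemma edge_countE P : \sum_(e in eset G | P e) weight G e = edge_count P.
Proof.
rewrite big_mkcondr; apply: eq_bigr => e _.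
by case: (P e); rewrite ?mulr1n ?mulr0n.
Qed.

Lemma edge_countD f g :
  edge_count f + edge_count g = edge_count (fun e => f e + g e)%N.
Proof. by rewrite -big_split; apply: eq_bigr => e _; rewrite /= mulrnDr. Qed.

Lemma eq_edge_count f g :
  {in eset G, forall e, f e = g e} -> edge_count f = edge_count g.
Proof. by move=> fg; apply: eq_bigr => e /fg ->. Qed.

(** An edge that the tensor obtained by contracting A still has as a
    dimension. *)
Definition open_edge A e :=
  touches G e A && (~~ (adj G e \subset A) || (e \in uncontracted G)).

Hypothesis netG : is_network G.

Lemma le_edge_count f g :
  {in eset G, forall e, (f e <= g e)%N} -> edge_count f <= edge_count g.
Proof.
move=> fg; apply: ler_sum => e eG.
by apply: ler_wpMn2l; [apply: weight_ge0|apply: fg].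
Qed.

Lemma edge_count_ge0 f : 0 <= edge_count f.
Proof. by apply: sumr_ge0 => e eG; rewrite mulrn_wge0// weight_ge0. Qed.

Lemma touches_outside A :
  {in eset G, forall e, touches G e (vset G :\: A) = ~~ (adj G e \subset A)}.
Proof.
move=> e eG; rewrite /touches -setD_eq0; congr (_ != set0).
apply/setP=> x; rewrite !inE andbC.
have /subsetP/(_ x) := adj_sub netG eG.
by case: (x \in adj G e) => [->|] //=; rewrite ?andbT ?andbF.
Qed.

Lemma net_cutE A : net_cut G A = edge_count (open_edge A).
Proof.
rewrite /net_cut /cut_between /cut_dangling !edge_countE edge_countD.
apply: eq_edge_count => e eG; rewrite touches_outside// /open_edge.
case: (boolP (adj G e \subset A)) => [sub|_]; last by rewrite andbT andbF addn0.
rewrite andbF andbT/= add0n.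
case: (boolP (e \in uncontracted G)) => [un|_]; last by rewrite andbF.
rewrite andbT; have := adj_uncontracted netG un.
by rewrite card_gt0 /touches (setIidPl sub) => ->.
Qed.

(** An edge that touches two disjoint sets is inside neither of them. *)
Lemma open_disjoint A B e : [disjoint A & B] ->
  open_edge A e && open_edge B e = touches G e A && touches G e B.
Proof.
have aux (X Y : {set V}) : [disjoint X & Y] -> touches G e Y -> ~~ (adj G e \subset X).
  move=> dXY /set0Pn[y /setIP[ye yY]]; apply/negP => /subsetP/(_ y ye) yX.
  by move/disjointFr: dXY => /(_ _ yX); rewrite yY.
move=> dAB; rewrite /open_edge.
case: (boolP (touches G e A)) => //= tA.
case: (boolP (touches G e B)) => [tB|_]; last by rewrite andbF.
by rewrite (aux _ _ dAB tB) (aux B A) // disjoint_sym.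
Qed.

Lemma contraction_costE A B : [disjoint A & B] ->
  contraction_cost G A B = edge_count (fun e => open_edge A e || open_edge B e).
Proof.
move=> dAB; rewrite /contraction_cost !net_cutE /cut_between edge_countE.
apply/eqP; rewrite subr_eq !edge_countD; apply/eqP/eq_edge_count => e _.
by rewrite -(open_disjoint _ dAB); case: (open_edge A e); case: (open_edge B e).
Qed.

Lemma cut_betweenC A B : cut_between G A B = cut_between G B A.
Proof.
rewrite /cut_between !edge_countE; apply: eq_edge_count => e _.
by rewrite andbC.
Qed.

Lemma contraction_costC A B : contraction_cost G A B = contraction_cost G B A.
Proof.
by rewrite /contraction_cost (addrC (net_cut G A)) cut_betweenC.
Qed.

Lemma net_cut_le_cost A B : [disjoint A & B] ->
  net_cut G A <= contraction_cost G A B.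
Proof.
move=> dAB; rewrite net_cutE contraction_costE//.
by apply: le_edge_count => e _; case: (open_edge A e).
Qed.

Lemma net_cutU_le_cost A B : [disjoint A & B] ->
  net_cut G (A :|: B) <= contraction_cost G A B.
Proof.
move=> dAB; rewrite net_cutE contraction_costE//.
apply: le_edge_count => e _.
suff: open_edge (A :|: B) e -> open_edge A e || open_edge B e.
  by case: (open_edge (A :|: B) e) => [->|].
rewrite /open_edge.
have -> : touches G e (A :|: B) = touches G e A || touches G e B.
  by rewrite /touches setIUr setU_eq0 negb_and.
case: (e \in uncontracted G); first by rewrite !orbT !andbT.
rewrite !orbF => /andP[t o].
have oA : ~~ (adj G e \subset A).
  by apply: contra o => /subset_trans-> //; apply: subsetUl.
have oB : ~~ (adj G e \subset B).
  by apply: contra o => /subset_trans-> //; apply: subsetUr.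
by rewrite oA oB !andbT.
Qed.

End EdgeCount.

Section Restrict.
Variables (R : realType) (V E : finType) (G : network R V E) (F : {set E}).

Lemma is_network_restrict : is_network G -> is_network (edge_restrict G F).
Proof.
case=> us ads au ac w; split=> /=.
- exact: setSI.
- by move=> e /setIP[/ads].
- by move=> e /setIP[/au].
- move=> e; rewrite !inE => /andP[/nandP[H|/negbTE H] /andP[eG eF]].
    by apply: ac; rewrite inE H.
  by rewrite eF in H.
- by move=> e /setIP[/w].
Qed.

Lemma sum_restrict (P P1 P2 : pred E) :
    (forall e, e \in F -> P1 e = P e) -> (forall e, e \notin F -> P2 e = P e) ->
  \sum_(e in eset G | P e) weight G e =
  \sum_(e in eset (edge_restrict G F) | P1 e) weight G e +
  \sum_(e in eset (edge_restrict G (~: F)) | P2 e) weight G e.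
Proof.
move=> h1 h2; rewrite (bigID (mem F)) /=; congr (_ + _); apply: eq_bigl => e.
  by rewrite !inE; case: (boolP (e \in F)) => [/h1->|]; rewrite !(andbT, andbF).
by rewrite !inE; case: (boolP (e \in F)) => [|/h2->]; rewrite !(andbT, andbF).
Qed.

Lemma cut_between_restrict A B : cut_between G A B =
  cut_between (edge_restrict G F) A B + cut_between (edge_restrict G (~: F)) A B.
Proof. exact: sum_restrict. Qed.

Lemma net_cut_restrict A : net_cut G A =
  net_cut (edge_restrict G F) A + net_cut (edge_restrict G (~: F)) A.
Proof.
rewrite /net_cut addrACA -cut_between_restrict; congr (_ + _).
by apply: sum_restrict => e eF; rewrite !inE eF andbT.
Qed.

Lemma contraction_cost_restrict A B : contraction_cost G A B =
  contraction_cost (edge_restrict G F) A B +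
  contraction_cost (edge_restrict G (~: F)) A B.
Proof.
rewrite /contraction_cost cut_between_restrict (net_cut_restrict A).
by rewrite (net_cut_restrict B); lra.
Qed.

End Restrict.

(** * Flow in a linearized graph *)

Section Flow.
Variables (R : realType) (V E : finType) (L : network R V E) (s : seq V).
Implicit Types (A B X Y : {set V}) (x y : V) (e : E).

Definition outgoing x e :=
  (x \in adj L e) && ((e \in uncontracted L) ||
    [exists y in adj L e, (index x s < index y s)%N]).

(** In a graph, an uncontracted edge leaves every set that contains its
    endpoint, and a contracted edge leaves the sets that contain its lower
    endpoint but not the other one. *)
Definition leaving A e := [exists x in A, outgoing x e] && open_edge L A e.

Definition entering A e := [exists x in ~: A, outgoing x e] && touches L e A.

Definition last_vertex A x :=
  x \in A /\ {in A, forall y, (index y s <= index x s)%N}.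

Lemma exists_last A : A != set0 -> exists x, last_vertex A x.
Proof.
case/set0Pn=> x0 x0A; exists [arg max_(x > x0 in A) index x s].
by case: arg_maxnP => // x xA h; split.
Qed.

Lemma last_leaving A x e : last_vertex A x -> outgoing x e -> leaving A e.
Proof.
move=> [xA lastx] out; apply/andP; split.
  by apply/existsP; exists x; rewrite xA.
case/andP: out => xe out; apply/andP; split.
  by apply/set0Pn; exists x; rewrite inE xe.
case/orP: out => [->|/existsP[y /andP[ye lt]]]; first by rewrite orbT.
apply/orP; left; apply/negP => /subsetP/(_ _ ye)/lastx.
by rewrite leqNgt lt.
Qed.

Hypotheses (netL : is_network L) (graphL : is_graph L).

(** A contracted edge leaves only its lower endpoint, a dangling one has a
    single endpoint; so the outgoing edges of distinct vertices are distinct,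
    and their weights add up. *)
Lemma outgoing_inj x y e :
  e \in eset L -> outgoing x e -> outgoing y e -> x = y.
Proof.
move=> eL /andP[xe outx] /andP[ye outy]; apply/eqP/negPn/negP => xy.
have sub : [set x; y] \subset adj L e by apply/subsetP=> z /set2P[]->.
have := subset_leq_card sub; rewrite cards2 xy graphL//.
case: ifPn => // un _; rewrite (negbTE un)/= in outx outy.
have adjE : adj L e = [set x; y].
  by apply/esym/eqP; rewrite eqEcard sub cards2 xy graphL// (negbTE un).
case/existsP: outx => z /andP[]; rewrite adjE => /set2P[]->; rewrite ?ltnn// => lt.
case/existsP: outy => t /andP[]; rewrite adjE => /set2P[]->; rewrite ?ltnn// => lt'.
by have := ltn_trans lt lt'; rewrite ltnn.
Qed.

(** Each edge that leaves A, leaves B or enters their union is open at A or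
    at B, and has one tail, which cannot be in two of the disjoint sets A, B
    and the complement of their union. *)
Lemma contraction_cost_flow A B : [disjoint A & B] ->
  edge_count L (entering (A :|: B)) + edge_count L (leaving A)
    + edge_count L (leaving B) <= contraction_cost L A B.
Proof.
move=> dAB; rewrite contraction_costE// !edge_countD; apply: le_edge_count => // e eL.
have excl X Y : [disjoint X & Y] -> [exists x in X, outgoing x e] ->
    [exists x in Y, outgoing x e] = false.
  move=> dXY /existsP[x /andP[xX ox]]; apply/existsP => -[y /andP[yY oy]].
  rewrite -(outgoing_inj eL ox oy) in yY.
  by rewrite (disjointFr dXY xX) in yY.
have dA : [disjoint A & ~: (A :|: B)].
  by rewrite disjoints_subset setCK subsetUl.
have dB : [disjoint B & ~: (A :|: B)].
  by rewrite disjoints_subset setCK subsetUr.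
rewrite /leaving /entering.
(* Three cases, according to where the tail of [e] lies. *)
case: (boolP [exists x in A, outgoing x e]) => [tA|_].
  rewrite (excl _ _ dAB tA) (excl _ _ dA tA) /= addn0 add0n.
  by case: (open_edge L A e).
case: (boolP [exists x in B, outgoing x e]) => [tB|_].
  rewrite (excl _ _ dB tB) /= !add0n orbC.
  by case: (open_edge L B e).
rewrite /= !addn0.
case: (boolP (_ && _)) => //= /andP[/existsP[x /andP[]]].
rewrite !inE negb_or => /andP[xA xB] /andP[xe _].
rewrite /touches setIUr setU_eq0 negb_and lt0b => t.
have out X : x \notin X -> ~~ (adj L e \subset X).
  by move=> xX; apply/negP => /subsetP/(_ x xe); rewrite (negbTE xX).
by rewrite /open_edge !out//= !andbT.
Qed.

(** An edge open at A whose tail lies in B enters A, so nothing else is counted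
    twice on the left. *)
Lemma net_cut_flow A B : [disjoint A & B] ->
  net_cut L A + edge_count L (leaving B) <=
  contraction_cost L A B + edge_count L (entering A).
Proof.
move=> dAB; rewrite contraction_costE// net_cutE// !edge_countD.
apply: le_edge_count => // e eL.
have : open_edge L A e -> leaving B e -> entering A e.
  move=> /andP[t _] /andP[/existsP[x /andP[xB ox]] _]; apply/andP; split=> //.
  by apply/existsP; exists x; rewrite inE (disjointFl dAB xB).
have : leaving B e -> open_edge L B e by case/andP.
case: (open_edge L A e); case: (leaving B e); case: (entering A e) => //=.
- by move=> _ /(_ isT isT).
- by move=> ->.
- by move=> ->.
Qed.

Lemma leaving_all :
  edge_count L (leaving (vset L)) <= \sum_(e in uncontracted L) weight L e.
Proof.
have -> : \sum_(e in uncontracted L) weight L e =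
    \sum_(e in eset L | e \in uncontracted L) weight L e.
  apply: eq_bigl => e; case: (boolP (e \in uncontracted L)) => [un|_].
    by rewrite (subsetP (uncontracted_sub netL) _ un).
  by rewrite andbF.
rewrite edge_countE; apply: le_edge_count => // e eL.
rewrite /leaving /open_edge adj_sub//=.
by case: (e \in uncontracted L); rewrite ?leq_b1// !andbF.
Qed.

Variable mu : R.
Hypothesis outgoing_ge :
  {in vset L, forall x, mu <= \sum_(e in eset L | outgoing x e) weight L e}.

Lemma leaving_ge A : A != set0 -> A \subset vset L ->
  mu <= edge_count L (leaving A).
Proof.
case/exists_last=> x lastx /subsetP/(_ x lastx.1)/outgoing_ge/le_trans; apply.
rewrite edge_countE; apply: le_edge_count => // e _.
by case: (boolP (outgoing x e)) => // /(last_leaving lastx)->.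
Qed.

(** The last vertex of the union sends its flow out of the union; the other
    set can lose flow on the way out only into the set that contains it. *)
Lemma leavingU A B : [disjoint A & B] -> A != set0 -> B != set0 ->
    A \subset vset L -> B \subset vset L ->
  exists2 X, X = A \/ X = B &
    mu + mu <= edge_count L (leaving (A :|: B)) + edge_count L (entering X).
Proof.
have aux A' B' x : [disjoint A' & B'] -> B' != set0 -> A' \subset vset L ->
    B' \subset vset L -> last_vertex (A' :|: B') x -> x \in A' ->
    mu + mu <=
      edge_count L (leaving (A' :|: B')) + edge_count L (entering A').
  move=> dAB /exists_last[y lasty] /subsetP sA /subsetP sB lastx xA.
  have yA : y \notin A' by rewrite (disjointFl dAB lasty.1).
  apply: (le_trans (lerD (outgoing_ge (sA _ xA)) (outgoing_ge (sB _ lasty.1)))).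
  rewrite !edge_countE !edge_countD; apply: le_edge_count => // e eL.
  (* An edge out of [y], the last vertex of B', avoids the union unless it
     goes into A'; an edge out of [x] always avoids it. *)
  case: (boolP (outgoing x e)) => [ox|_].
    rewrite (last_leaving lastx ox); case: (boolP (outgoing y e)) => // oy.
    by rewrite -(outgoing_inj eL ox oy) xA in yA.
  case: (boolP (outgoing y e)) => // oy.
  have := last_leaving lasty oy; rewrite /leaving /entering.
  case: (boolP (touches L e A')) => [t _|t].
    suff -> : [exists x0 in ~: A', outgoing x0 e] by exact: leq_addl.
    by apply/existsP; exists y; rewrite inE yA.
  move=> /andP[_ /andP[tB o]].
  suff -> : [exists x0 in A' :|: B', outgoing x0 e] &&
    open_edge L (A' :|: B') e by [].
  apply/andP; split.
    by apply/existsP; exists y; rewrite inE lasty.1 orbT.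
  rewrite /open_edge /touches setIUr setU_eq0 negb_and.
  apply/andP; split; first by apply/orP; right.
  case/orP: o => [/subsetPn[z ze zB]|->]; last by rewrite orbT.
  apply/orP; left; apply/subsetPn; exists z => //; rewrite inE negb_or zB andbT.
  by apply: contra t => zA; apply/set0Pn; exists z; rewrite inE ze zA.
move=> dAB A0 B0 sA sB.
have /exists_last[x lastx] : A :|: B != set0 by rewrite setU_eq0 negb_and A0.
case/setUP: (lastx.1) => [xA|xB].
  by exists A; [left|apply: aux lastx xA].
exists B; first by right.
by rewrite setUC in lastx *; apply: aux lastx xB => //; rewrite disjoint_sym.
Qed.

End Flow.

(** * Charging along a contraction tree *)

Section Tree.
Variables (R : realType) (V : finType) (C : {set V} -> {set V} -> R).
Implicit Types (t : ctree V) (A B W D X P Q : {set V}).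

Lemma leaves_neq0 t : leaves t != set0.
Proof.
elim: t => [v|l IHl r _] /=; first by apply/set0Pn; exists v; rewrite set11.
by rewrite setU_eq0 negb_and IHl.
Qed.

Lemma contractions_sub t A B : (A, B) \in contractions t ->
  [/\ A != set0, B != set0, A \subset leaves t & B \subset leaves t].
Proof.
elim: t => [//|l IHl r IHr] /=; rewrite inE mem_cat.
case/or3P=> [/eqP[-> ->]|/IHl|/IHr].
- by rewrite !leaves_neq0 subsetUl subsetUr.
- by case=> -> -> sA sB; split=> //; apply: subset_trans (subsetUl _ _).
- by case=> -> -> sA sB; split=> //; apply: subset_trans (subsetUr _ _).
Qed.

Lemma contractions_uniq t : disjoint_children t -> uniq (contractions t).
Proof.
elim: t => [//|l IHl r IHr] /= /and3P[/IHl ul /IHr ur dlr].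
have sep A : A != set0 -> A \subset leaves l -> A \subset leaves r -> False.
  case/set0Pn=> x xA /subsetP/(_ x xA) xl /subsetP/(_ x xA).
  by rewrite (disjointFr dlr xl).
rewrite mem_cat negb_or cat_uniq ul ur andbT /=; apply/andP; split.
  apply/andP; split; apply/negP => /contractions_sub[nl nr sl sr].
    exact: sep nr sr (subxx _).
  exact: sep nl (subxx _) sl.
apply/hasPn => -[A B] /contractions_sub[nA _ sA _]; apply/negP.
by case/contractions_sub=> _ _ /sep/(_ sA).
Qed.

Definition total_cost t : R := \sum_(p <- contractions t) C p.1 p.2.

Definition top_cost t : R :=
  if t is CNode l r then C (leaves l) (leaves r) else 0.

(** Each contraction comes with the total cost of itself, of the contractions
    that formed its two operands, and of the one that consumes its result;
    [up] is the cost of the contraction that consumes the root. *)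
Fixpoint neighbourhoods t (up : R) : seq ({set V} * {set V} * R) :=
  if t is CNode l r then
    let k := C (leaves l) (leaves r) in
    (leaves l, leaves r, k + top_cost l + top_cost r + up)
      :: neighbourhoods l k ++ neighbourhoods r k
  else [::].

(** The bounds on neighbouring costs that can be read off [z]. An operand that
    is a leaf has no contraction that forms it, and the root W none that
    consumes it. *)
Record neighbourhood_of W A B (z : R) : Prop := NeighbourhoodOf {
  nbh_disjoint : [disjoint A & B];
  nbh_neq0 : A != set0 /\ B != set0;
  nbh_sub : A \subset W /\ B \subset W;
  nbh_self : C A B <= z;
  nbh_operand : forall X, X = A \/ X = B ->
    (exists x, X = [set x]) \/
    exists P Q, [/\ [disjoint P & Q], P != set0, Q != set0, X = P :|: Q &
                    C P Q <= z];
  nbh_result : A :|: B = W \/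
    exists D, [/\ [disjoint A :|: B & D], D != set0, D \subset W &
                  C (A :|: B) D <= z] }.

Lemma neighbourhoods_keys t up : map fst (neighbourhoods t up) = contractions t.
Proof. by elim: t up => [//|l IHl r IHr] up /=; rewrite map_cat IHl IHr. Qed.

Hypothesis C_ge0 : forall A B, 0 <= C A B.

Lemma top_cost_ge0 t : 0 <= top_cost t.
Proof. by case: t => /=. Qed.

(** A contraction is counted for itself, as the consumer of two operands, and
    at most once as the source of an operand. The top cost on the left keeps
    room in the induction for this last use. *)
Lemma sum_neighbourhoods t up : 0 <= up ->
  \sum_(q <- neighbourhoods t up) q.2 + top_cost t <= 4 * total_cost t + up.
Proof.
rewrite /total_cost; elim: t up => [v|l IHl r IHr] up /=.
  by rewrite !big_nil; lra.
rewrite !big_cons !big_cat /= => _; set k := C _ _.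
have k0 : 0 <= k by exact: C_ge0.
by have := IHl k k0; have := IHr k k0; lra.
Qed.

Hypothesis C_sym : forall A B, C A B = C B A.

Lemma neighbourhoodsP t W up A B z :
    disjoint_children t -> leaves t \subset W -> 0 <= up ->
    leaves t = W \/ (exists D, [/\ [disjoint leaves t & D], D != set0,
                               D \subset W & C (leaves t) D <= up]) ->
  (A, B, z) \in neighbourhoods t up -> neighbourhood_of W A B z.
Proof.
elim: t up => [//|l IHl r IHr] up /= /and3P[dl dr dlr].
rewrite subUset => /andP[sl sr] up0 result.
set k := C (leaves l) (leaves r).
have k0 : 0 <= k by exact: C_ge0.
have := top_cost_ge0 l; have := top_cost_ge0 r => tr0 tl0.
rewrite inE mem_cat => /or3P[/eqP[-> -> ->]|/IHl|/IHr].
- split=> //; first by rewrite !leaves_neq0.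
  + by rewrite -/k; lra.
  + move=> X X_lr; have : exists2 t', X = leaves t' &
        disjoint_children t' /\ top_cost t' <= k + top_cost l + top_cost r + up.
      by case: X_lr => ->; [exists l|exists r] => //; split=> //; lra.
    case=> -[v|P Q] -> /= [dj le]; first by left; exists v.
    right; exists (leaves P), (leaves Q); split=> //; try exact: leaves_neq0.
    by case/and3P: dj.
  + case: result => [|[D [dD D0 sD le]]]; first by left.
    by right; exists D; split=> //; apply: (le_trans le); lra.
- apply=> //; right; exists (leaves r).
  by split=> //; exact: leaves_neq0.
- apply=> //; right; exists (leaves l); rewrite disjoint_sym.
  by split=> //; [exact: leaves_neq0|rewrite C_sym].
Qed.

Lemma neighbourhoods_ge0 t up q :
  0 <= up -> q \in neighbourhoods t up -> 0 <= q.2.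
Proof.
elim: t up => [//|l IHl r IHr] up /= up0; rewrite inE mem_cat.
case/or3P=> [/eqP->|/IHl|/IHr]; try exact.
by rewrite /= !addr_ge0// top_cost_ge0.
Qed.

(** A leaf is an operand of only one contraction, and a contraction has at
    most two leaves as operands. *)
Lemma sum_leaves (F : V -> R) t up : disjoint_children t -> 0 <= up ->
    (forall x, t = CLeaf x -> F x <= up) ->
    (forall x B, [disjoint [set x] & B] -> B != set0 -> B \subset leaves t ->
       x \in leaves t -> F x <= C [set x] B) ->
  \sum_(x in leaves t) F x <= 2 * total_cost t + up.
Proof.
rewrite /total_cost; elim: t up => [v|l IHl r IHr] up /=.
  move=> _ _ /(_ v erefl) le _; rewrite big_set1 big_nil; lra.
case/and3P=> dl dr dlr up0 _ leafC; rewrite big_cons big_cat /=.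
rewrite (eq_bigl [predU leaves l & leaves r]); last by move=> x; rewrite !inE.
rewrite bigU //=; set k := C _ _.
have k0 : 0 <= k by exact: C_ge0.
have le_l : \sum_(x in leaves l) F x <=
    2 * \sum_(p <- contractions l) C p.1 p.2 + k.
  apply: IHl => // [x lE|x B dB B0 sB xl].
    rewrite /k lE /=; apply: leafC; rewrite ?leaves_neq0 ?subsetUr//.
      by move: dlr; rewrite lE.
    by rewrite lE !inE eqxx.
  by apply: leafC; rewrite // ?inE ?xl// (subset_trans sB)// subsetUl.
have le_r : \sum_(x in leaves r) F x <=
    2 * \sum_(p <- contractions r) C p.1 p.2 + k.
  apply: IHr => // [x rE|x B dB B0 sB xr].
    rewrite /k C_sym rE /=; apply: leafC; rewrite ?leaves_neq0 ?subsetUl//.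
      by move: dlr; rewrite disjoint_sym rE.
    by rewrite rE !inE eqxx orbT.
  by apply: leafC; rewrite // ?inE ?xr ?orbT// (subset_trans sB)// subsetUr.
lra.
Qed.

End Tree.

(** Each [j] is charged only by the two indices [f j] and [g j], and only once
    by each because [s] has no duplicates. *)
Lemma sum_charge (R : realType) (I J : eqType) (s : seq I) (t : seq J)
    (f g : J -> I) (Y : I -> R) (Z : J -> R) :
    uniq s -> {in t, forall j, 0 <= Z j} ->
    {in s, forall i, exists j, [/\ j \in t, f j = i \/ g j = i & Y i <= Z j]} ->
  \sum_(i <- s) Y i <= 2 * \sum_(j <- t) Z j.
Proof.
move=> us Z0 charge.
have once (h : J -> I) :
    \sum_(i <- s) \sum_(j <- t | h j == i) Z j <= \sum_(j <- t) Z j.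
  rewrite (exchange_big_dep predT)//= big_seq [leRHS]big_seq.
  apply: ler_sum => j jt; case: (boolP (h j \in s)) => [hs|hs].
    rewrite -big_filter (_ : [seq i <- s | h j == i] = [:: h j]) ?big_seq1//.
    rewrite (eq_filter (a2 := pred1 (h j))); last by move=> i; rewrite /= eq_sym.
    by rewrite filter_pred1_uniq.
  rewrite big1_seq ?Z0// => i /andP[/eqP hi is_].
  by rewrite hi is_ in hs.
apply: (@le_trans _ _ (\sum_(i <- s) (\sum_(j <- t | f j == i) Z j
                                    + \sum_(j <- t | g j == i) Z j))).
  rewrite big_seq [leRHS]big_seq; apply: ler_sum => i.
  case/charge=> j [jt fg /le_trans]; apply.
  have pos (h : J -> I) : 0 <= \sum_(j <- t | h j == i) Z j.
    by rewrite big_seq_cond sumr_ge0// => j' /andP[/Z0].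
  have ge (h : J -> I) : h j = i -> Z j <= \sum_(j <- t | h j == i) Z j.
    move=> hj; rewrite (big_rem j jt) /= hj eqxx lerDl.
    by rewrite big_seq_cond sumr_ge0// => j' /andP[/mem_rem/Z0].
  have := pos f; have := pos g.
  by case: fg => /ge; lra.
by rewrite big_split /=; have := once f; have := once g; lra.
Qed.

(** * The term of one contraction *)

Section Term.
Variables (R : realType) (V E : finType) (H : network R V E).
Implicit Types (A B : {set V}).

Lemma sqrt_expR (x : R) : Num.sqrt (expR x) = expR (x / 2).
Proof.
have {1}-> : x = x / 2 + x / 2 by lra.
by rewrite expRD -expr2 sqrtr_sqr ger0_norm// expR_ge0.
Qed.

Lemma y_termC A B (m : R) : y_term H A B m = y_term H B A m.
Proof.
have aC X Y : a_factor H X Y = c_factor H Y X.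
  by rewrite /a_factor /c_factor cut_betweenC.
have dC : d_factor H A B = d_factor H B A.
  by rewrite /d_factor setUC (aC A B) -(aC B A) (mulrC (a_factor H B A)).
have bC : b_factor H A B = b_factor H B A.
  by rewrite /b_factor dC cut_betweenC.
rewrite /y_term dC bC (aC A B) -(aC B A) minC.
move: (a_factor H B A) (b_factor H B A) (c_factor H B A) (d_factor H B A).
by move=> a b c d; congr (_ + _ * Num.sqrt _ * _); ring.
Qed.

(** The second summand is at most the geometric mean of the bounds on the
    cost of forming an operand and of consuming the result; [rho] cancels in
    it. *)
Lemma y_term_le A B (mu rho z : R) :
    expR (contraction_cost H A B + mu + mu) <= z ->
    expR (net_cut H A + mu + mu + rho) <= z \/
      expR (net_cut H B + mu + mu + rho) <= z ->
    expR (net_cut H (A :|: B) + mu + mu + mu - rho) <= z ->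
  y_term H A B (expR mu) <= 2 * z.
Proof.
(* A geometric mean is at most the larger of the two costs. *)
have mean (x y t : R) : expR x <= z -> expR y <= z -> 2 * t <= x + y -> expR t <= z.
  move=> xz yz txy; case: (lerP t x) => tx.
    by apply: le_trans xz; rewrite ler_expR.
  by apply: le_trans yz; rewrite ler_expR; lra.
move=> self operand result; rewrite /y_term.
set al := net_cut H A - cut_between H A B.
set ga := net_cut H B - cut_between H A B.
set de := net_cut H (A :|: B) - al - ga.
have dE : d_factor H A B = expR de.
  by rewrite /d_factor -expRD -expRN -expRD opprD addrA.
have bE : b_factor H A B = expR (cut_between H A B - de).
  by rewrite /b_factor dE -expRN -expRD.
rewrite dE bE /a_factor /c_factor -/al -/ga expr2.
rewrite -!expRD !sqrt_expR -!expRD.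
have first_le :
    expR (al + (cut_between H A B - de) + ga + de + (mu + mu)) <= z.
  by apply: le_trans self; rewrite ler_expR /contraction_cost /al /ga; lra.
set second := expR (mu + mu + de + _).
suff : second * Num.min (expR (al / 2)) (expR (ga / 2)) <= z.
  by move=> second_le; rewrite mulr_natl mulr2n lerD.
case: operand => operand.
  apply: (@le_trans _ _ (second * expR (al / 2))).
    by rewrite ler_wpM2l ?expR_ge0// ge_min lexx.
  rewrite /second -expRD; apply: (mean _ _ _ operand result); rewrite /de /al /ga; lra.
apply: (@le_trans _ _ (second * expR (ga / 2))).
  by rewrite ler_wpM2l ?expR_ge0// ge_min lexx orbT.
rewrite /second -expRD; apply: (mean _ _ _ operand result); rewrite /de /al /ga; lra.
Qed.

End Term.

(** * Costs in the combined network *)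

Section Sketch.
Variables (R : realType) (V E : finType) (GD GE : network R V E).
Variables (N : nat) (e : 'I_N -> E) (v : 'I_N -> V) (s : seq V).
Hypotheses (dataD : is_data GD e v) (uniD : uniform_sketch_dims GD e).
Hypotheses (embE : is_embedding GD GE e) (orderS : vertex_ordering GD GE s).
Implicit Types (A B : {set V}) (x : V) (a : E).

Let G := full_network GD GE.
Let L := left_network GD GE.
Let H := right_network GD GE.
Let VD := vset GD.

Let netD : is_network GD := data_network dataD.
Let netE : is_network GE := embedding_network embE.

Lemma data_embedding x : x \in VD -> x \in vset GE = false.
Proof. exact: disjointFr (embedding_vertices embE). Qed.

Lemma embedding_adj a x : a \in eset GE -> x \in adj GE a -> x \in vset GE.
Proof. by move=> aE; apply/subsetP/(adj_sub netE). Qed.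

Lemma shared_edge a : a \in eset GD -> a \in eset GE -> exists j, a = e j.
Proof.
move=> aD aE; have : a \in eset GD :&: eset GE by rewrite inE aD.
by rewrite (embedding_shared embE) => /imsetP[j _ ->]; exists j.
Qed.

Lemma sketched_edge j : e j \in eset GD /\ e j \in eset GE.
Proof.
suff : e j \in eset GD :&: eset GE by move/setIP.
by rewrite (embedding_shared embE) imset_f.
Qed.

Lemma sketched_vertexP j : v j \in VD.
Proof.
have [eD _] := sketched_edge j; have := adj_sub netD eD.
by rewrite (sketched_adj dataD) sub1set.
Qed.

Lemma data_vertex x : x \in VD -> exists j, x = v j.
Proof.
by case/uniD=> j; rewrite (sketched_adj dataD) => /set1P->; exists j.
Qed.

Lemma input_vertex j : exists2 x, adj GE (e j) = [set x] & x \in vset GE.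
Proof.
have [_ eE] := sketched_edge j.
have := embedding_graph embE eE; rewrite (embedding_inputs embE).
move=> /eqP/cards1P[x xE]; exists x => //.
by apply: (embedding_adj eE); rewrite xE set11.
Qed.

Lemma adj_sketched j x : adj GE (e j) = [set x] -> adj G (e j) = [set v j; x].
Proof.
have [eD eE] := sketched_edge j.
by rewrite /= eD eE (sketched_adj dataD) => ->.
Qed.

Lemma full_is_network : is_network G.
Proof.
split=> /=.
- apply/subsetP=> a; rewrite !inE => /andP[_ /orP[]].
    by move=> /(subsetP (uncontracted_sub netD))->.
  by move=> /(subsetP (uncontracted_sub netE))->; rewrite orbT.
- move=> a _; rewrite subUset; apply/andP; split.
    case: ifP => [aD|_]; last exact: sub0set.
    exact: subset_trans (adj_sub netD aD) (subsetUl _ _).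
  case: ifP => [aE|_]; last exact: sub0set.
  exact: subset_trans (adj_sub netE aE) (subsetUr _ _).
- move=> a; rewrite !inE => /andP[_ /orP[un|un]].
    rewrite (subsetP (uncontracted_sub netD) _ un).
    apply: leq_trans (adj_uncontracted netD un) _.
    exact/subset_leq_card/subsetUl.
  rewrite (subsetP (uncontracted_sub netE) _ un).
  apply: leq_trans (adj_uncontracted netE un) _.
  exact/subset_leq_card/subsetUr.
- move=> a; rewrite !inE => /andP[].
  case: (boolP (a \in eset GD)) => aD;
    case: (boolP (a \in eset GE)) => aE //= un _.
  + have [j aj] := shared_edge aD aE; have [x xE xVE] := input_vertex j.
    rewrite aj xE (sketched_adj dataD) cards2.
    (* A shared edge joins [v j] to the embedding vertex [x]. *)
    by rewrite (contraFneq _ (data_embedding (sketched_vertexP j))) // => ->.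
  + rewrite setU0; apply: (adj_contracted netD); rewrite inE aD andbT.
    by apply: contra un => ->.
  + rewrite set0U; apply: (adj_contracted netE); rewrite inE aE andbT.
    by apply: contra un => ->; rewrite orbT.
- move=> a; rewrite inE; case: ifP => [aD _|_ /=]; first exact: weight_ge0.
  exact: weight_ge0.
Qed.

Let netG := full_is_network.
Let netL : is_network L := is_network_restrict (eset GE) netG.
Let netH : is_network H := is_network_restrict (~: eset GE) netG.

Lemma left_is_graph : is_graph L.
Proof.
move=> a; rewrite !inE => /andP[_ aE]; rewrite /= aE !andbT.
case: (boolP (a \in eset GD)) => aD /=.
  have [j aj] := shared_edge aD aE; have [x xE xVE] := input_vertex j.
  rewrite aj xE (sketched_adj dataD) cards2.
  by rewrite (contraFneq _ (data_embedding (sketched_vertexP j))) // => ->.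
rewrite set0U (embedding_graph embE aE).
suff -> : a \in uncontracted GD = false by [].
by apply: contraNF aD => /(subsetP (uncontracted_sub netD)).
Qed.

Lemma right_adj a : a \in eset H -> adj H a \subset VD.
Proof.
rewrite !inE => /andP[/orP[aD|aE] naE]; last by rewrite aE in naE.
by rewrite /= aD (negbTE naE) setU0 (adj_sub netD aD).
Qed.

Lemma right_touches a A : a \in eset H ->
  touches H a (A :&: VD) = touches H a A.
Proof.
by move=> /right_adj sub; rewrite /touches setICA (setIidPl sub) setIC.
Qed.

Lemma right_net_cut A : net_cut H (A :&: VD) = net_cut H A.
Proof.
rewrite !net_cutE//; apply: eq_edge_count => a aH.
by rewrite /open_edge right_touches// subsetI right_adj// andbT.
Qed.

Lemma right_contraction_cost A B :
  contraction_cost H (A :&: VD) (B :&: VD) = contraction_cost H A B.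
Proof.
rewrite /contraction_cost !right_net_cut; congr (_ - _).
rewrite /cut_between !edge_countE; apply: eq_edge_count => a aH.
by rewrite !right_touches.
Qed.

(** The only edge of the left network at a data vertex is directed away from
    it, because data vertices come first in the ordering. *)
Lemma entering_data x : x \in VD -> edge_count L (entering L s [set x]) = 0.
Proof.
move=> xD; apply: big1 => a aL; suff -> : entering L s [set x] a = false by [].
apply/negbTE/negP => /andP[/existsP[y /andP[]]].
rewrite !inE => yx oy /set0Pn[z /setIP[xa /set1P zx]]; rewrite {z}zx in xa.
have aE : a \in eset GE by move: aL; rewrite !inE => /andP[].
have aD : a \in eset GD.
  move: xa => /=; rewrite aE; case: (a \in eset GD) => //.
  by rewrite set0U => /(embedding_adj aE); rewrite data_embedding.
have [j aj] := shared_edge aD aE; have [t tE tVE] := input_vertex j.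
have adjE : adj L a = [set v j; t] by rewrite aj; apply: adj_sketched.
have xv : x = v j.
  move: xa; rewrite adjE => /set2P[] // xt.
  by move: (data_embedding xD); rewrite xt tVE.
have yt : y = t.
  by case/andP: oy; rewrite adjE => /set2P[] // yv; rewrite xv yv eqxx in yx.
have lt : (index x s < index y s)%N.
  by case: orderS => _ _ ord; apply: ord; rewrite ?yt.
case/andP: oy => _ /orP[|/existsP[z]].
  by rewrite /= !inE aD aE.
rewrite adjE -xv -yt => /andP[/set2P[]->]; last by rewrite ltnn.
by rewrite ltnNge ltnW.
Qed.

Let mu := \sum_(a in output_edges GD GE) weight G a.

Hypothesis sketched_gt : forall j, sketch_size GD GE < expR (weight GD (e j)).
Hypothesis sufficient : {in vset GE, forall x,
  ln (sketch_size GD GE) <= linearization_cut GD GE s x}.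

Lemma outgoing_ge_mu : {in vset L, forall x,
  mu <= \sum_(a in eset L | outgoing L s x a) weight L a}.
Proof.
move=> x; rewrite inE => /orP[xD|xE]; last first.
  by apply: le_trans (sufficient xE); rewrite /sketch_size expRK.
have [j xj] := data_vertex xD; have [t tE tVE] := input_vertex j.
have [eD eE] := sketched_edge j.
have eL : e j \in eset L by rewrite !inE eD eE.
have out : outgoing L s x (e j).
  have adjL : adj L (e j) = [set v j; t] := adj_sketched tE.
  rewrite /outgoing adjL xj set21; apply/orP; right.
  apply/existsP; exists t; rewrite set22 /=.
  by case: orderS => _ _; apply => //; rewrite -xj.
rewrite (bigD1 (e j)) /=; last by rewrite eL.
have : mu < weight GD (e j) by rewrite -ltr_expR.
rewrite eD => /ltW/le_trans; apply; rewrite lerDl.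
by apply: sumr_ge0 => i /andP[/andP[/(weight_ge0 netL)]].
Qed.

Let leaving_ge_mu A := leaving_ge netL outgoing_ge_mu (A := A).

Lemma cost_split A B : contraction_cost G A B =
  contraction_cost L A B + contraction_cost H (A :&: VD) (B :&: VD).
Proof. by rewrite right_contraction_cost; apply: contraction_cost_restrict. Qed.

(** Nothing enters a data vertex, so what leaves the other operand is paid for
    in addition to all edges open at the vertex. *)
Lemma leaf_cost x B : x \in VD -> [disjoint [set x] & B] -> B != set0 ->
  B \subset vset G -> expR (net_cut G [set x]) * sketch_size GD GE <=
  expR (contraction_cost G [set x] B).
Proof.
move=> xD dB B0 sB; rewrite /sketch_size -expRD ler_expR -/mu.
have := net_cut_flow s netL dB; rewrite entering_data// addr0.
have := leaving_ge_mu B0 sB; have := net_cut_le_cost netH dB.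
rewrite (net_cut_restrict G (eset GE)) (contraction_cost_restrict G (eset GE)).
by rewrite -/L -/H; lra.
Qed.

(** Let X be the operand whose entering flow is charged. If [rho] is that flow,
    then forming X costs at least [2 mu + rho] in flow and consuming the result
    of (A, B) at least [3 mu - rho]. When X is a leaf, [rho = 0]; when the result is
    the root, only [mu] leaves it, so [rho >= mu]; in both cases the
    contraction (A, B) itself replaces the missing neighbour. *)
Lemma neighbourhood_term A B z :
    neighbourhood_of (fun A B => expR (contraction_cost G A B)) (vset G) A B z ->
    A :&: VD != set0 -> B :&: VD != set0 ->
  y_term H (A :&: VD) (B :&: VD) (sketch_size GD GE) <= 2 * z.
Proof.
case=> dAB [A0 B0] [sA sB] self operand result AD BD.
have dD : [disjoint A :&: VD & B :&: VD].
  by apply: disjointWl (disjointWr _ dAB); apply: subsetIl.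
have self_cost : mu + mu + contraction_cost H (A :&: VD) (B :&: VD) <=
    contraction_cost G A B.
  have := contraction_cost_flow s netL left_is_graph dAB.
  have := edge_count_ge0 netL (entering L s (A :|: B)).
  by have := leaving_ge_mu A0 sA; have := leaving_ge_mu B0 sB; rewrite cost_split; lra.
have [X AX flowX] :=
  leavingU netL left_is_graph outgoing_ge_mu dAB A0 B0 sA sB.
set rho := edge_count L (entering L s X) in flowX.
have XD : X :&: VD != set0 by case: AX => ->.
have cutX : net_cut H (X :&: VD) <= contraction_cost H (A :&: VD) (B :&: VD).
  case: AX => ->; first exact: net_cut_le_cost.
  by rewrite contraction_costC; apply: net_cut_le_cost; rewrite // disjoint_sym.
apply: (@y_term_le _ _ _ _ _ _ mu rho).
- by apply: le_trans self; rewrite ler_expR; lra.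
- suff : expR (net_cut H (X :&: VD) + mu + mu + rho) <= z.
    by case: AX => ->; [left|right].
  case: (operand X AX) => [[x Xx]|[P [Q [dPQ P0 Q0 XPQ le]]]].
    apply: le_trans self; rewrite ler_expR.
    suff -> : rho = 0 by lra.
    rewrite /rho Xx; apply: entering_data.
    by case/set0Pn: XD => y; rewrite Xx => /setIP[/set1P->].
  have sX : X \subset vset G by case: AX => ->.
  move: sX; rewrite XPQ subUset => /andP[sP sQ].
  apply: le_trans le; rewrite ler_expR.
  have := contraction_cost_flow s netL left_is_graph dPQ; rewrite -XPQ -/rho.
  have := leaving_ge_mu P0 sP; have := leaving_ge_mu Q0 sQ.
  have := net_cutU_le_cost netH dPQ; rewrite -XPQ.
  by rewrite cost_split right_contraction_cost right_net_cut; lra.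
- rewrite -setIUl; case: result => [AB|[D [dD' D0 sD le]]].
    apply: le_trans self; rewrite ler_expR.
    have := net_cutU_le_cost netH dD; rewrite -setIUl.
    have : edge_count L (leaving L s (A :|: B)) <= mu.
      by rewrite AB; apply: leaving_all.
    by lra.
  apply: le_trans le; rewrite ler_expR.
  have := contraction_cost_flow s netL left_is_graph dD'.
  have := edge_count_ge0 netL (entering L s (A :|: B :|: D)).
  have := leaving_ge_mu D0 sD.
  have := net_cut_le_cost netH dD'.
  by rewrite cost_split right_contraction_cost right_net_cut; lra.
Qed.

End Sketch.

(** * The lower bound *)

Theorem theoremD1 (R : realType) :
  exists2 c : R, 0 < c &
  forall (V E : finType) (GD GE : network R V E)
         (N : nat) (e : 'I_N -> E) (v : 'I_N -> V) (T0 TB : ctree V)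
         (eps delta k1 k2 k3 : R),
  let G := full_network GD GE in
  let m := sketch_size GD GE in
  is_data GD e v ->
  uniform_sketch_dims GD e ->
  contraction_tree GD T0 ->
  is_embedding GD GE e ->
  (forall j, m < expR (weight GD (e j))) ->
  0 < eps -> 0 < delta < 1 -> 0 < k1 -> 0 < k2 -> 0 < k3 ->
  accurate_one_output GD GE eps delta k1 k2 ->
  k3 * (N%:R * ln (delta^-1) / eps ^+ 2) <= m ->
  contraction_tree G TB ->
  constrained_on (vset GD) T0 TB ->
  c * (\sum_(j < N) expR (net_cut G [set v j]) * m
       + \sum_(p <- contractions T0) y_term (right_network GD GE) p.1 p.2 m)
    <= tree_cost G TB.
Proof.
(* The leaves cost at most twice the tree. A term is at most twice the cost of
   a neighbourhood, the neighbourhoods add up to at most four times the tree,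
   and each is charged at most twice: 2 + 2 * 4 * 2 = 18. *)
exists 18^-1; first by rewrite invr_gt0.
move=> V E GD GE N e v T0 TB eps delta k1 k2 k3 G m dataD uniD [djT0 T0D] embE.
move=> sketched_gt _ _ _ _ _ [_ _ [s orderS sufficient]] _ [djTB TBG] constr.
pose C A B := expR (contraction_cost G A B).
have netG : is_network G := full_is_network dataD embE.
have C_ge0 A B : 0 <= C A B by exact: expR_ge0.
have C_sym A B : C A B = C B A by rewrite /C contraction_costC.
have costE : tree_cost G TB = total_cost C TB by [].
have VD_sub : vset GD \subset leaves TB by rewrite TBG; apply: subsetUl.
have leaf_sum : \sum_(j < N) expR (net_cut G [set v j]) * m <=
    2 * tree_cost G TB.
  pose F x := if x \in vset GD then expR (net_cut G [set x]) * m else 0.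
  apply: (@le_trans _ _ (\sum_(x in leaves TB) F x)).
    have vD j : v j \in vset GD := sketched_vertexP dataD embE j.
    rewrite (eq_bigr (F \o v)); last by move=> j _; rewrite /F /= vD.
    rewrite -(big_imset (h := v) F (A := predT)) /=; last first.
      by move=> i j _ _; apply: (sketched_vertex_inj dataD).
    have F0 x : 0 <= F x.
      by rewrite /F; case: ifP => // _; rewrite mulr_ge0// expR_ge0.
    have sub : [set v j | j in 'I_N] \subset leaves TB.
      by apply/subsetP=> _ /imsetP[j _ ->]; apply: (subsetP VD_sub).
    rewrite [leRHS](big_setID [set v j | j in 'I_N]) /= (setIidPr sub).
    by rewrite lerDl sumr_ge0.
  rewrite costE -[leRHS]addr0; apply: sum_leaves => //.
    (* The tree is not a single leaf: there is a data vertex, hence a sketched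
       edge, hence an embedding vertex. *)
    move=> x TBx; have [y yD] : exists y, y \in vset GD.
      by rewrite -T0D; apply/set0Pn/leaves_neq0.
    have [j _] := uniD _ yD; have [t _ tE] := input_vertex embE j.
    have vj := sketched_vertexP dataD embE j.
    have TB1 : leaves TB = [set x] by rewrite TBx.
    have: v j \in [set x] by rewrite -TB1 (subsetP VD_sub).
    have: t \in [set x] by rewrite -TB1 TBG inE tE orbT.
    move=> /set1P tx /set1P vx; move: (data_embedding embE vj).
    by rewrite vx -tx tE.
  move=> x B dB B0 sB _; rewrite /F; case: ifP => // xD.
  by rewrite TBG in sB; apply: (leaf_cost dataD uniD embE orderS sketched_gt sufficient).
have term_sum :
    \sum_(p <- contractions T0) y_term (right_network GD GE) p.1 p.2 m <=
    2 * \sum_(q <- neighbourhoods C TB 0) 2 * q.2.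
  apply: (sum_charge (f := fun q => (q.1.1 :&: vset GD, q.1.2 :&: vset GD))
                     (g := fun q => (q.1.2 :&: vset GD, q.1.1 :&: vset GD))).
  - exact: contractions_uniq.
  - by move=> q /neighbourhoods_ge0 q0; rewrite mulr_ge0// q0.
  move=> [U W] UW; have [U0 W0 _ _] := contractions_sub UW.
  have [A [B [AU BW AB]]] := constr _ _ UW.
  have near X Y : (X, Y) \in contractions TB -> X :&: vset GD != set0 ->
      Y :&: vset GD != set0 -> exists2 z, (X, Y, z) \in neighbourhoods C TB 0 &
      y_term (right_network GD GE) (X :&: vset GD) (Y :&: vset GD) m <= 2 * z.
    rewrite -(neighbourhoods_keys C TB 0) => /mapP[[[X' Y'] z] zin /=].
    move=> [-> ->] XD YD.
    exists z => //.
    apply: (neighbourhood_term dataD uniD embE orderS sketched_gt sufficient) => //.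
    by apply: neighbourhoodsP zin => //; rewrite TBG; [|left].
  case: AB => /near; rewrite AU BW.
    by case=> // z zin le; exists (A, B, z); split=> //; left; rewrite /= AU BW.
  case=> // z zin le; exists (B, A, z); split=> //; last by rewrite y_termC.
  by right; rewrite /= AU BW.
have := sum_neighbourhoods C_ge0 TB (lexx 0).
have := top_cost_ge0 C_ge0 TB.
move: term_sum leaf_sum; rewrite -mulr_sumr -costE => *.
rewrite mulrC ler_pdivrMr//; lra.
Qed.
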